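(* Let $n\in\mathbb N$, $\phi\in[1/n,1]$ and $\varepsilon\in(0,1/2]$. There exists an undirected graph with general conductance $\phi_\varepsilon=\Theta(\phi)$ such that any algorithm with access to $\mathcal{O}$ requires $\Omega(n/\phi_\varepsilon)$ queries to output $\hat n$ such that $|n-\hat n|\le\frac{\varepsilon-\delta}{2-\varepsilon-\delta}n$ with probability at least $2/3$, for any $\delta<\varepsilon/2$.
   Context: General conductance (for an undirected graph, each edge is regarded as two opposite directed edges): for $\emptyset\ne S\subsetneq V$, $\deg^+(S)=|\{(u,v)\in E:u\in S\}|$, $\partial S=\{(u,v)\in E:u\in S,v\notin S\}$, $\phi(S)=|\partial S|/\deg^+(S)$; $\phi_\varepsilon(G)=\min\{\phi(S):S\subseteq V,\ 1\le|S|\le(1-\varepsilon)|V|\}$. Neighbour query oracle $\mathcal{O}$: graph stored as adjacency lists in arbitrary order; it keeps a set $S$ of revealed nodes and uses the consecutive labelling $\ell$ (each newly revealed node gets the smallest unused natural number). On $\mathsf{init}$ it picks a node $v$, sets $S=\{v\}$, returns $(\ell(v),\deg(v))$. On $(l,i)$: if $v\in S$ has $\ell(v)=l$ and $i\le\deg(v)$, it returns $(\ell(u),\deg(u))$ for $u$ the $i$-th entry of $v$'s adjacency list and adds $u$ to $S$; otherwise $\mathsf{null}$. Each query costs one unit.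
   Formalization: Here δ is taken positive (0<δ<ε/2), the claim failing for δ≤0; ''any algorithm'' means one that is accurate with probability 2/3 on all graphs with φ_ε=Θ(φ), since a constant output succeeds on one graph; the constants and the graph may depend on ε and δ. *)

(* Defs.v *)
From HB Require Import structures.
From mathcomp Require Import all_boot all_order all_algebra.
From mathcomp Require Import all_classical all_reals all_analysis.
Set Implicit Arguments.
Unset Strict Implicit.
Unset Printing Implicit Defensive.
Import Order.TTheory GRing.Theory Num.Theory.
Local Open Scope ring_scope.

Record ugraph := UGraph {
  vertex :> finType;
  edge : rel vertex;
  edge_sym : symmetric edge;
  edge_irrefl : irreflexive edge }.

Definition deg (G : ugraph) (v : G) : nat := #|[set u : G | edge v u]|.

Section Conductance.
Variables (R : realType) (G : ugraph).

Definition outdeg (S : {set G}) : nat :=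
  #|[set e : G * G | edge e.1 e.2 && (e.1 \in S)]|.

Definition boundary (S : {set G}) : {set G * G} :=
  [set e : G * G | [&& edge e.1 e.2, e.1 \in S & e.2 \notin S]].

(* When S consists of isolated vertices this is 0 / 0 = 0. *)
Definition conductance (S : {set G}) : R :=
  #|boundary S|%:R / (outdeg S)%:R.

(* Every conductance is at most 1, so the unit 1 of the iterated minimum does
   not affect the value unless no set S is admissible. *)
Definition gen_conductance (eps : R) : R :=
  \big[Num.min/1]_(S : {set G} |
      (1 <= #|S|)%N && (#|S|%:R <= (1 - eps) * #|G|%:R)) conductance S.

End Conductance.

(* A deterministic implementation of the oracle: the order of the adjacency
   lists and the node picked on init are arbitrary but fixed. *)
Record oracle (G : ugraph) := Oracle {
  adj : G -> seq G;
  start : G;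
  adj_uniq : forall v, uniq (adj v);
  adj_edge : forall v u, (u \in adj v) = edge v u }.

Variant query := Init | Neighbour of nat & nat.

(* (label, degree), or None for null *)
Definition answer := option (nat * nat).

(* The state s lists the revealed nodes in order of discovery, so the
   consecutive label of v is index v s. Adjacency entries are counted from 1. *)
Definition respond (G : ugraph) (O : oracle G) (s : seq G) (x : query)
    : answer * seq G :=
  match x with
  | Init => (Some (0%N, deg (start O)), [:: start O])
  | Neighbour l i =>
      if (onth s l, i) is (Some v, j.+1) then
        if onth (adj O v) j is Some u then
          let s' := if u \in s then s else rcons s u in
          (Some (index u s', deg u), s')
        else (None, s)
      else (None, s)
  end.

Variant action (R : Type) := Ask of query | Output of R.

(* The next action as a function of the answers received so far; the queries
   asked so far are determined by these answers. *)
Definition strategy (R : Type) := seq answer -> action R.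

Fixpoint run (R : Type) (A : strategy R) (G : ugraph) (O : oracle G)
    (q : nat) (s : seq G) (h : seq answer) : option R :=
  match A h with
  | Output x => Some x
  | Ask y =>
      if q is q'.+1 then
        let: (a, s') := respond O s y in run A O q' s' (rcons h a)
      else None
  end.

(* The output of A if it is produced after at most q queries, Init included *)
Definition output_within (R : Type) (A : strategy R) (G : ugraph)
    (O : oracle G) (q : nat) : option R := run A O q [::] [::].

(* The internal randomness is an arbitrary probability space, independent of
   the oracle; measurability makes the events below measurable. *)
Record rand_algorithm (R : realType) := RandAlgorithm {
  coin_display : measure_display;
  coin : measurableType coin_display;
  coin_law : probability coin R;
  strat : coin -> strategy R;
  strat_ask_measurable : forall (h : seq answer) (y : query),
    measurable [set w | strat w h = Ask R y]%classic;
  strat_output_measurable : forall (h : seq answer) (B : set R),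
    measurable B ->
    measurable [set w | exists2 x : R, B x & strat w h = Output x]%classic }.

Section Estimation.
Variables (R : realType) (A : rand_algorithm R) (G : ugraph) (O : oracle G).
Variable alpha : R.

Definition accurate (x : R) : bool := `|#|G|%:R - x| <= alpha * #|G|%:R.

Definition estimates_within (q : nat) : Prop :=
  ((2 / 3)%:E <= coin_law A [set w : coin A | exists2 x : R,
      output_within (strat w) O q = Some x & accurate x]%classic)%E.

Definition estimates : Prop :=
  ((2 / 3)%:E <= coin_law A [set w : coin A | exists q : nat, exists2 x : R,
      output_within (strat w) O q = Some x & accurate x]%classic)%E.

End Estimation.

(* Main.v *)
Require Import Defs.
From HB Require Import structures.
From mathcomp Require Import all_boot all_order all_algebra.
From mathcomp Require Import all_classical all_reals all_analysis.
From mathcomp Require Import measurable_realfun fingroup perm.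
From mathcomp Require Import zify ring lra.
Set Implicit Arguments.
Unset Strict Implicit.
Unset Printing Implicit Defensive.
Import Order.TTheory GRing.Theory Num.Theory.
Local Open Scope ring_scope.

(* Take the clique on X * bool, |X| = r, and reroute the k edges
   {(x, false), (x, true)} with x in K through a new hub vertex carrying L leaves.
   Degrees of the clique are unchanged, so an algorithm learns about the hub only
   by probing a rerouted edge. With k of order phi n and L of order n, the hub with
   its leaves has conductance of order k / L, and this is the bottleneck: the clique
   part exceeds a (1 - eps + delta / 8) fraction of the vertices, so an admissible
   set misses a constant fraction of the clique.

   Two values of L give graphs whose sizes n and n' satisfy
   n (1 - delta) < n' (1 - eps), so that no estimate is accurate for both. Shifting
   the two copies of X independently by (x, y) yields r ^ 2 oracles for each graph;
   a probed clique edge is rerouted in at most k of them, so a run with q queries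
   can tell the two graphs apart for at most q k shifts. For each shift both runs
   are accurate with probability at least 1 / 3, hence r ^ 2 / 3 <= q k. *)

(** * General conductance, cliques and hub graphs *)

Section PairCounting.
Local Open Scope nat_scope.

Lemma card_pairE (T : finType) (P : T -> T -> bool) :
  #|[set e : T * T | P e.1 e.2]| = \sum_x \sum_y (P x y : nat).
Proof.
rewrite pair_bigA /= -sum1_card [LHS]big_mkcond /=.
by apply: eq_bigr => -[x y] _; rewrite inE; case: (P _ _).
Qed.

Lemma card_setE (T : finType) (P : pred T) :
  #|[set x | P x]| = \sum_x (P x : nat).
Proof.
rewrite -sum1_card [LHS]big_mkcond /=.
by apply: eq_bigr => x _; rewrite inE; case: (P _).
Qed.

Lemma boundary_le_outdeg (G : ugraph) (S : {set G}) : #|boundary S| <= outdeg S.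
Proof.
apply/subset_leq_card/fintype.subsetP => e; rewrite !inE.
by move=> /and3P[-> ->].
Qed.

End PairCounting.

Section GenConductance.
Variables (R : realType) (G : ugraph).

Lemma gen_conductance_le (eps : R) (S : {set G}) :
  (0 < #|S|)%N -> #|S|%:R <= (1 - eps) * #|G|%:R ->
  gen_conductance G eps <= conductance R S.
Proof. by move=> S0 Sle; apply: bigmin_le_cond; rewrite S0. Qed.

Lemma gen_conductance_le1 (eps : R) : gen_conductance G eps <= 1.
Proof. exact: bigmin_le_id. Qed.

(** A nonempty boundary makes the out-degree positive, which rules out the value 0 / 0 = 0 and lets
    the division be cleared. The bound [c <= 1] handles the unit of the iterated minimum. *)
Lemma gen_conductance_ge (eps c : R) : c <= 1 ->
  (forall S : {set G}, (0 < #|S|)%N -> #|S|%:R <= (1 - eps) * #|G|%:R ->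
     (0 < #|boundary S|)%N /\ c * (outdeg S)%:R <= #|boundary S|%:R) ->
  c <= gen_conductance G eps.
Proof.
move=> c1 H; apply: le_bigmin => // S /andP[S0 Sle].
have [b0 bS] := H S S0 Sle.
rewrite /conductance ler_pdivlMr // ltr0n.
exact: leq_trans b0 (boundary_le_outdeg S).
Qed.

End GenConductance.

Section Clique.
Variable T : finType.

Definition clique_edge : rel T := fun u v => u != v.

Lemma clique_edge_sym : symmetric clique_edge.
Proof. by move=> u v; rewrite /clique_edge eq_sym. Qed.

Lemma clique_edge_irrefl : irreflexive clique_edge.
Proof. by move=> u; rewrite /clique_edge eqxx. Qed.

Definition clique : ugraph := UGraph clique_edge_sym clique_edge_irrefl.

Lemma clique_boundary (S : {set clique}) : #|boundary S| = (#|S| * #|~: S|)%N.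
Proof.
rewrite -cardsX; apply: eq_card => e; rewrite !inE /= /clique_edge.
case: (e.1 =P e.2) => [->|_] //=.
by case: (_ \in _).
Qed.

Lemma clique_outdeg (S : {set clique}) : (outdeg S <= #|S| * #|T|)%N.
Proof.
rewrite -cardsT -cardsX; apply/subset_leq_card/fintype.subsetP => e.
by rewrite !inE /= andbT => /andP[].
Qed.

(** An admissible set misses at least [eps * #|T|] vertices, and each of its own vertices is
    adjacent to all of them. Cliques serve the case where n is bounded in terms of delta. *)
Lemma clique_gen_conductance (R : realType) (eps : R) :
  0 < eps -> eps <= 1 -> eps <= gen_conductance clique eps.
Proof.
move=> e0 e1; apply: gen_conductance_ge => // S S0 Sle.
have cS : #|~: S|%:R = #|T|%:R - #|S|%:R :> R.
  by rewrite -(cardsC S) natrD addrC addKr.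
have epsS : eps * #|T|%:R <= #|~: S|%:R by rewrite cS; lra.
have T0 : (0 < #|T|)%N by rewrite -(cardsC S) ltn_addr.
have cS0 : (0 < #|~: S|)%N.
  by rewrite -(ltr0n R); apply: lt_le_trans epsS; rewrite mulr_gt0 ?ltr0n.
rewrite clique_boundary; split; first by rewrite muln_gt0 S0.
have out := clique_outdeg S.
rewrite -(ler_nat R) natrM in out.
rewrite natrM; apply: le_trans (_ : eps * (#|S|%:R * #|T|%:R) <= _).
  by rewrite ler_pM2l.
by rewrite mulrCA ler_wpM2l.
Qed.

End Clique.

Section Hub.
Local Open Scope nat_scope.
Variables (X : finType) (K : {set X}) (L : nat).

Definition matched (t u : X * bool) : bool := (t.1 == u.1) && (t.1 \in K).

Definition hub_vertex : Type := (X * bool) + option 'I_L.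

HB.instance Definition _ := Finite.on hub_vertex.

(* [inr None] is the hub: every edge {(x, false), (x, true)} of the clique on
   X * bool with x in K is rerouted through it, which preserves the degrees of
   the clique, and L leaves hang from it. *)
Definition hub_edge : rel hub_vertex := fun v w =>
  match v, w with
  | inl t, inl u => (t != u) && ~~ matched t u
  | inl t, inr None => t.1 \in K
  | inr None, inl t => t.1 \in K
  | inr None, inr (Some _) => true
  | inr (Some _), inr None => true
  | _, _ => false
  end.

Lemma hub_edge_sym : symmetric hub_edge.
Proof.
move=> [t|[i|]] [u|[j|]] //=.
by rewrite eq_sym /matched [u.1 == _]eq_sym; case: (t.1 =P u.1) => //= ->.
Qed.

Lemma hub_edge_irrefl : irreflexive hub_edge.
Proof. by move=> [t|[i|]] //=; rewrite eqxx. Qed.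

Definition hub : ugraph := UGraph hub_edge_sym hub_edge_irrefl.

Lemma card_hub : #|hub| = #|X| * 2 + L.+1.
Proof. by rewrite card_sum card_prod card_bool card_option card_ord. Qed.

Lemma sum_hub (F : hub_vertex -> nat) :
  \sum_(v : hub) F v =
  \sum_t F (inl t) + (F (inr None) + \sum_j F (inr (Some j))).
Proof.
rewrite big_sumType /=; congr (_ + _).
rewrite (bigD1 None) //=; congr (_ + _).
rewrite (reindex_omap Some id) /=; last by case.
by apply: eq_bigl => j; rewrite eqxx.
Qed.

Section HubCut.
Variable S : {set hub}.
Let inner := [set t : X * bool | inl t \in S].
Let leaves := [set j : 'I_L | inr (Some j) \in S].
Let centre := inr None \in S.

Lemma hub_outdeg_le :
  outdeg S <= #|inner| * (#|X| * 2) +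
    (if centre then #|K| * 2 + L else 0) + #|leaves|.
Proof.
rewrite /outdeg (card_pairE (fun v w => hub_edge v w && (v \in S))) sum_hub.
rewrite -addnA; apply: leq_add; last apply: leq_add.
- rewrite card_setE big_distrl /=; apply: leq_sum => t _.
  rewrite sum_hub /= [X in _ + (_ + X)]big1 // addn0.
  case: (inl t \in S); last first.
    by rewrite andbF big1 // => u _; rewrite andbF.
  rewrite mul1n andbT.
  have -> : #|X| * 2 = \sum_(u : X * bool) 1.
    by rewrite sum1_card card_prod card_bool.
  (* [t] is not its own neighbour; the unit saved here pays for a possible edge to the hub. *)
  rewrite (bigD1 t) //= eqxx andFb add0n.
  rewrite [X in _ <= X](bigD1 t) //= addnC leq_add //; first exact: leq_b1.
  by apply: leq_sum => u _; exact: leq_b1.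
- rewrite sum_hub /= -/centre; case: centre; last first.
    by rewrite !big1 // => u _; rewrite andbF.
  rewrite add0n; apply: leq_add.
    have -> : #|K| * 2 = #|finset.setX K [set: bool]| by rewrite cardsX cardsT card_bool.
    rewrite -sum1_card [X in _ <= X]big_mkcond /=; apply: leq_sum => u _.
    by rewrite !inE !andbT; case: (_ \in _).
  by rewrite sum1_card card_ord.
- rewrite card_setE; apply: leq_sum => j _; rewrite sum_hub /=.
  by rewrite !big1 // addn0; case: (_ \in _).
Qed.

(** Compared with the clique, each vertex of [inner] loses at most one boundary edge, the one to its
    partner. If the hub is in [S], its [#|K| * 2] clique edges leave [S] unless they end in [inner];
    otherwise each leaf in [S] has its edge on the boundary. The two losses add up to
    [#|inner| * 2]. *)
Lemma hub_boundary_ge :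
  #|inner| * #|~: inner| + (if centre then #|K| * 2 else #|leaves|) <=
  #|boundary S| + #|inner| * 2.
Proof.
rewrite /boundary.
rewrite (card_pairE (fun v w => [&& hub_edge v w, v \in S & w \notin S])) sum_hub.
set A := \sum_t _; set B := \sum_w _; set C := \sum_j _.
have hA : #|inner| * #|~: inner| <= A + #|inner|.
  rewrite {1 2}card_setE big_distrl -big_split /=; apply: leq_sum => t _.
  case tS: (inl t \in S); last by [].
  rewrite mul1n.
  have partner : \sum_u (u == (t.1, ~~ t.2)) = nat_of_bool true.
    by rewrite (bigD1 (t.1, ~~ t.2)) //= eqxx big1 // => u /negbTE ->.
  rewrite -[nat_of_bool true]partner.
  rewrite -sum1_card big_mkcond sum_hub /= addnAC -big_split /=.
  rewrite -[X in X <= _]addn0; apply: leq_add => //.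
  apply: leq_sum => u _; rewrite !inE /=; case uS: (inl u \in S) => //=.
  rewrite /matched; case: (t =P u) => [tu|/eqP]; first by rewrite -tu tS in uS.
  case: t {tS partner} => x b; case: u {uS} => y c /=.
  rewrite !xpair_eqE [y == x]eq_sym; case: (x =P y) => //= ->.
  by case: b; case: c; case: (y \in K).
rewrite [#|inner| * 2]muln2 -addnn.
have hBC : (if centre then #|K| * 2 else #|leaves|) <= B + C + #|inner|.
  rewrite /B /C; case cS: centre.
    apply: (@leq_trans (B + #|inner|)); last by rewrite leq_add2r leq_addr.
    have -> : #|K| * 2 = #|finset.setX K [set: bool]|.
      by rewrite cardsX cardsT card_bool.
    rewrite [#|inner|]card_setE -sum1_card big_mkcond /B sum_hub /= addnAC -big_split /=.
    rewrite -[X in X <= _]addn0; apply: leq_add => //.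
    apply: leq_sum => t _; rewrite !inE andbT -/centre cS /=.
    by case: (_ \in K); case: (_ \in S).
  rewrite card_setE; apply: (@leq_trans C); last first.
    by rewrite addnAC leq_addl.
  apply: leq_sum => j _; rewrite sum_hub /= -/centre cS /=.
  by case: (_ \in S); lia.
by rewrite addnACA; exact: leq_add.
Qed.

End HubCut.

Definition star : {set hub} := [set v | if v is inr _ then true else false].

Lemma card_star : #|star| = L.+1.
Proof. by rewrite card_setE sum_hub /= big1 // sum1_card card_ord. Qed.

Lemma star_boundary_le : #|boundary star| <= #|K| * 2.
Proof.
have -> : #|K| * 2 = #|finset.setX K [set: bool]| by rewrite cardsX cardsT card_bool.
rewrite /boundary.
rewrite (card_pairE (fun v w => [&& hub_edge v w, v \in star & w \notin star])).
rewrite sum_hub big1 ?add0n => [|t _]; last first.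
  by rewrite big1 // => w _; rewrite inE andbF.
rewrite [X in _ + X]big1 ?addn0 => [|j _]; last first.
  by rewrite sum_hub /= !big1 // !inE.
rewrite sum_hub [X in _ + X]big1 => [|j _]; last by rewrite !inE.
rewrite addn0 -sum1_card [X in _ <= X]big_mkcond /=; apply: leq_sum => t _.
by rewrite !inE !andbT; case: (_ \in K).
Qed.

Lemma star_outdeg_ge : L * 2 <= outdeg star.
Proof.
rewrite /outdeg (card_pairE (fun v w => hub_edge v w && (v \in star))) sum_hub.
apply: leq_trans (leq_addl _ _); rewrite muln2 -addnn; apply: leq_add.
  rewrite sum_hub; apply: leq_trans (leq_addl _ _).
  rewrite inE /= add0n -[X in X <= _]card_ord -sum1_card.
  by apply: leq_sum.
rewrite -[X in X <= _]card_ord -sum1_card; apply: leq_sum => j _.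
by rewrite sum_hub /= inE /= addnCA leq_addr.
Qed.

End Hub.

Section HubConductance.
Variables (R : realType) (X : finType) (K : {set X}) (L : nat) (eps : R).

(** Let N be the size of the clique part and s that of [inner]. An admissible set misses at least g
    N clique vertices, so the clique part contributes about s g N boundary edges; as 4 <= g N, half
    of them survive the loss of 2 s. Against an out-degree of at most s N this gives the ratio g /
    2, and the hub side is compared separately. *)
Lemma hub_gen_conductance_ge (g c : R) :
  0 < g -> 4 <= g * (#|X| * 2)%:R ->
  (1 - eps + g) * #|hub K L|%:R <= (#|X| * 2)%:R ->
  (0 < #|K|)%N -> 0 <= c -> c <= 1 -> c <= g / 2 ->
  c * (#|K| * 2 + L * 2)%:R <= (#|K| * 2)%:R ->
  c <= gen_conductance (hub K L) eps.
Proof.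
move=> g0 gX epsX K0 c0 c1 cg cK; apply: gen_conductance_ge => // S S0 Sle.
have out := hub_outdeg_le S; have bnd := hub_boundary_ge S.
move: out bnd; set inner := [set t | _]; set leaves := [set j | _].
set centre := _ \in S => out bnd.
have leavesL : (#|leaves| <= L)%N by rewrite -[X in (_ <= X)%N]card_ord max_card.
(* [a] and [b] are the shares of the hub side in the lower bound for the boundary and the upper
   bound for the out-degree. With the hub in [S], the leaf edges count twice, once from each end;
   without it, every edge from a leaf of [S] crosses the boundary. *)
have [a [b [la lb cab a0]]] : exists a b : nat, [/\
    (#|inner| * #|~: inner| + a <= #|boundary S| + #|inner| * 2)%N,
    (outdeg S <= #|inner| * (#|X| * 2) + b)%N, c * b%:R <= a%:R &
    ((0 < #|inner|) || (0 < a))%N].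
  case: (boolP centre) => cS; rewrite ?cS ?(negbTE cS) in out bnd.
    exists (#|K| * 2)%N, (#|K| * 2 + L * 2)%N; split=> //.
      by apply: leq_trans out _; lia.
    by rewrite muln_gt0 K0 orbT.
  exists #|leaves|, #|leaves|; split=> //; first by rewrite addn0 in out.
    by rewrite -[leRHS]mul1r ler_wpM2r.
  have [[t|[j|]] vS] := card_gt0P S0.
  - by apply/orP; left; apply/card_gt0P; exists t; rewrite inE.
  - by apply/orP; right; apply/card_gt0P; exists j; rewrite inE.
  - by rewrite /centre vS in cS.
have inS : (#|inner| <= #|S|)%N.
  rewrite -(card_imset inner (@inl_inj _ (option 'I_L))).
  by apply/subset_leq_card/fintype.subsetP => _ /imsetP[t + ->]; rewrite inE.
have cardT : (#|inner| + #|~: inner| = #|X| * 2)%N.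
  by rewrite cardsC card_prod card_bool.
have XV : (#|X| * 2 <= #|hub K L|)%N by rewrite card_hub leq_addr.
rewrite -(ltr0n R).
move: la lb cab cardT inS XV gX epsX Sle.
rewrite -!(ler_nat R) !natrD ![(#|inner| * _)%:R]natrM.
move: (#|hub K L|%:R : R) (#|boundary S|%:R : R) => V B.
move: (#|S|%:R : R) ((outdeg S)%:R : R) => sz D.
move=> la lb cab /(congr1 (fun m => m%:R : R)); rewrite natrD.
have : 0 <= #|inner|%:R :> R by [].
have a0' : 0 <= a%:R :> R by [].
have pos : 0 < #|inner|%:R :> R \/ 0 < a%:R :> R.
  by move/orP: a0; rewrite !ltr0n.
move: la lb cab pos a0' {a0}.
move: (#|inner|%:R : R) (#|~: inner|%:R : R) (a%:R : R) (b%:R : R).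
move: ((#|X| * 2)%:R : R) => N s s' {}a {}b la lb cab pos a0' s0 sN inS XV gX epsX Sle.
have s'g : g * N <= s'.
  have : g * N <= g * V by rewrite ler_pM2l.
  by lra.
have ss' : s * (g * N) <= s * s' by rewrite ler_wpM2l.
have s4 : s * 4 <= s * (g * N) by rewrite ler_wpM2l.
have Bge : s * (g * N) / 2 + a <= B by lra.
have N0 : 0 <= N by rewrite -sN addr_ge0 //; apply: le_trans s'g; nra.
split.
  case: pos => p; first by have : 0 < s * 4; lra.
  by lra.
apply: le_trans Bge; apply: le_trans (_ : c * (s * N + b) <= _).
  by rewrite ler_wpM2l.
rewrite mulrDr lerD //.
have : (g / 2 - c) * (s * N) >= 0 by rewrite mulr_ge0 ?mulr_ge0 // subr_ge0.
by lra.
Qed.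

Lemma hub_gen_conductance_le : (0 < L)%N ->
  L.+1%:R <= (1 - eps) * #|hub K L|%:R ->
  gen_conductance (hub K L) eps <= #|K|%:R / L%:R.
Proof.
move=> L0 Lle; apply: le_trans (gen_conductance_le (S := star K L) _ _) _.
- by rewrite card_star.
- by rewrite card_star.
have := star_boundary_le K L; have := star_outdeg_ge K L.
rewrite /conductance -!(ler_nat R) !natrM => out bnd.
have L0' : 0 < L%:R :> R by rewrite ltr0n.
rewrite ler_pdivrMr; last by lra.
rewrite mulrAC ler_pdivlMr //.
apply: le_trans (_ : #|K|%:R * 2%:R * L%:R <= _); first by rewrite ler_wpM2r.
by rewrite -mulrA ler_wpM2l // mulrC.
Qed.

End HubConductance.

(** * Simulating runs on a hub graph by runs on the clique *)

Section Simulation.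
Variable Out : Type.
Implicit Type A : strategy Out.

Lemma run_mono A (G : ugraph) (O : oracle G) q d s h x :
  run A O q s h = Some x -> run A O (q + d) s h = Some x.
Proof.
elim: q s h => [|q IH] s h /=.
  by case E: (A h) => [y|z] //; case: d => [|d] /=; rewrite E.
by case: (A h) => [y|z] //; case: (respond O s y) => a s'; exact: IH.
Qed.

Lemma output_within_unique A (G : ugraph) (O : oracle G) q q' x x' :
  output_within A O q = Some x -> output_within A O q' = Some x' -> x = x'.
Proof.
move=> /(run_mono q') e /(run_mono q).
by rewrite addnC e => -[].
Qed.

(** The list has length at most one: [Init] and queries answered by null read no adjacency entry. *)
Definition probed (G : ugraph) (O : oracle G) (s : seq G) (y : query)
    : seq (G * G) :=
  if y is Neighbour l j.+1 then
    if onth s l is Some v then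
      if onth (adj O v) j is Some u then [:: (v, u)] else [::]
    else [::]
  else [::].

Fixpoint touched A (G : ugraph) (O : oracle G) (q : nat) (s : seq G)
    (h : seq answer) : seq (G * G) :=
  match A h, q with
  | Ask y, q'.+1 =>
      probed O s y ++
        touched A O q' (respond O s y).2 (rcons h (respond O s y).1)
  | _, _ => [::]
  end.

Lemma size_touched A (G : ugraph) (O : oracle G) q s h :
  (size (touched A O q s h) <= q)%N.
Proof.
elim: q s h => [|q IH] s h /=; case: (A h) => [y|z] //=.
rewrite size_cat -(add1n q) leq_add // /probed.
by case: y => // l [|j] //; case: (onth s l) => // v; case: (onth _ j).
Qed.

Lemma touched_edge A (G : ugraph) (O : oracle G) q s h :
  {in touched A O q s h, forall e, edge e.1 e.2}.
Proof.
elim: q s h => [|q IH] s h e /=; case: (A h) => [y|z] //=.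
rewrite mem_cat => /orP[|]; last exact: IH.
rewrite /probed; case: y => // l [|j] //; case: (onth s l) => // v.
case E: (onth _ j) => [u|] //; rewrite inE => /eqP -> /=.
by rewrite -(adj_edge O); apply/onthP; exists j.
Qed.

Lemma deg_size_adj (G : ugraph) (O : oracle G) (v : G) : deg v = size (adj O v).
Proof.
rewrite /deg -(card_uniqP (adj_uniq O v)); apply: eq_card => u.
by rewrite inE adj_edge.
Qed.

Variables (H G : ugraph) (OH : oracle H) (OG : oracle G) (f : H -> G).
Variable good : H * H -> bool.
Hypothesis f_inj : injective f.
Hypothesis f_start : start OG = f (start OH).
Hypothesis f_size : forall v, size (adj OG (f v)) = size (adj OH v).
Hypothesis f_good : forall v j u, onth (adj OH v) j = Some u -> good (v, u) ->
  onth (adj OG (f v)) j = Some (f u).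

Let f_deg v : deg (f v) = deg v.
Proof. by rewrite (deg_size_adj OG) (deg_size_adj OH) f_size. Qed.

(** Equal list lengths give equal degrees and the same null answers, while injectivity of [f]
    preserves the order of discovery and hence the labels. So [f] need not preserve edges: it is
    enough that the entries actually read correspond. *)
Lemma respond_sim s y : all good (probed OH s y) ->
  respond OG (map f s) y = ((respond OH s y).1, map f (respond OH s y).2).
Proof.
case: y => [|l [|j]] /=; first by rewrite f_start f_deg.
  by case: (onth _ l); case: (onth _ l).
rewrite onth_map; case: (onth s l) => [v|] //=.
case E: (onth (adj OH v) j) => [u|] /=.
  rewrite andbT => /(f_good E) ->; rewrite mem_map // f_deg.
  by case: (u \in s); rewrite -?map_rcons index_map.
by move=> _; rewrite onth_default // f_size -onthNE E.
Qed.

Lemma run_sim A q s h : all good (touched A OH q s h) ->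
  run A OG q (map f s) h = run A OH q s h.
Proof.
elim: q s h => [|q IH] s h /=; case: (A h) => [y|z] //.
rewrite all_cat => /andP[gy gr]; rewrite respond_sim //.
by move: gr; case: (respond OH s y) => a s' /= /IH.
Qed.

End Simulation.

(** * Oracles for the clique and for the relabelled hub graphs, and the shifts *)

Section CliqueOracle.
Variables (T : finType) (t0 : T).

Definition clique_adj (v : clique T) : seq (clique T) :=
  [seq u <- enum T | u != v].

Lemma clique_adj_uniq v : uniq (clique_adj v).
Proof. by rewrite filter_uniq // enum_uniq. Qed.

Lemma clique_adj_edge v u : (u \in clique_adj v) = edge v u.
Proof. by rewrite mem_filter mem_enum andbT eq_sym. Qed.

Definition clique_oracle : oracle (clique T) :=
  Oracle (t0 : clique T) clique_adj_uniq clique_adj_edge.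

End CliqueOracle.

Section HubOracle.
Variables (X : finType) (K : {set X}) (L : nat) (t0 : X * bool).
Variable sigma : {perm (X * bool)%type}.

Definition hub_nbr (t u : X * bool) : hub K L :=
  if matched K t u then inr None else inl u.

(** The order is that of [enum] before applying [sigma], so the list of [inl (sigma t)] agrees
    position by position with the clique list of [t], up to relabelling; the hub takes the place of
    a rerouted partner. *)
Definition hub_adj (v : hub K L) : seq (hub K L) :=
  if v is inl t then
    [seq hub_nbr t (sigma u) | u <- enum {: X * bool} & sigma u != t]
  else [seq w <- enum (hub K L) | edge v w].

Lemma matched_partner t u : u != t -> matched K t u -> u = (t.1, ~~ t.2).
Proof.
case: t => x b; case: u => y c ne /andP[/= /eqP xy _]; subst y; congr pair.
by apply/eqP; move: ne; rewrite xpair_eqE eqxx; case: b; case: c.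
Qed.

(** Only one vertex can be the partner of [t], so the hub enters its list at most once. *)
Lemma hub_adj_uniq v : uniq (hub_adj v).
Proof.
case: v => [t|v]; last by rewrite filter_uniq // enum_uniq.
rewrite /hub_adj.
rewrite map_inj_in_uniq; first by rewrite filter_uniq // enum_uniq.
move=> u u'.
rewrite !mem_filter => /andP[ut _] /andP[u't _]; rewrite /hub_nbr.
case: (boolP (matched K t (sigma u))) => m;
  case: (boolP (matched K t (sigma u'))) => m' // e; last first.
  by case: e => /perm_inj.
by apply/(@perm_inj _ sigma); rewrite (matched_partner ut m) (matched_partner u't m').
Qed.

Lemma hub_adj_edge v w : (w \in hub_adj v) = edge v w.
Proof.
case: v => [t|v]; last by rewrite mem_filter mem_enum andbT.
apply/mapP/idP => [[u]|].
  rewrite mem_filter => /andP[ut _] ->; rewrite /hub_nbr.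
  case: (boolP (matched K t (sigma u))) => m; first by case/andP: m.
  by rewrite /= eq_sym ut m.
case: w => [u|[j|]] //=.
  move=> /andP[tu m]; exists ((sigma^-1)%g u).
    by rewrite mem_filter permKV eq_sym tu mem_enum.
  by rewrite /hub_nbr permKV (negbTE m).
move=> tK; exists ((sigma^-1)%g (t.1, ~~ t.2)).
  rewrite mem_filter permKV mem_enum andbT.
  by case: (t) => x b; rewrite xpair_eqE eqxx /=; case: b.
by rewrite /hub_nbr permKV /matched eqxx tK.
Qed.

Definition hub_oracle : oracle (hub K L) :=
  Oracle (inl (sigma t0) : hub K L) hub_adj_uniq hub_adj_edge.

(** The right-hand side does not depend on [L], so two hub graphs of different sizes yield the same
    output as long as no rerouted edge is probed. *)
Lemma hub_output (Out : Type) (A : strategy Out) q :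
  all (fun e => ~~ matched K (sigma e.1) (sigma e.2))
    (touched A (clique_oracle t0) q [::] [::]) ->
  output_within A hub_oracle q = output_within A (clique_oracle t0) q.
Proof.
have adjE t : hub_adj (inl (sigma t)) =
    [seq hub_nbr (sigma t) (sigma u) | u <- clique_adj t].
  rewrite /=; congr map; apply: eq_filter => u.
  by rewrite (inj_eq (@perm_inj _ sigma)).
move=> good.
apply: (@run_sim _ _ _ (clique_oracle t0) hub_oracle
  (fun t => inl (sigma t) : hub K L) _ _ _ _ _ A q [::] [::] good) => //.
- by move=> t u [] /perm_inj.
- by move=> v; rewrite /= -/(hub_adj (inl (sigma v))) adjE size_map.
- move=> v j u E /= g; rewrite -/(hub_adj (inl (sigma v))) adjE onth_map E /=.
  by rewrite /hub_nbr (negbTE g).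
Qed.

End HubOracle.

Section Shift.
Variable X : finZmodType.

Definition shift (p : X * X) (t : X * bool) : X * bool :=
  (t.1 + (if t.2 then p.2 else p.1), t.2).

Lemma shift_inj p : injective (shift p).
Proof. by move=> [x b] [y c] [] /[swap] <- /addIr ->. Qed.

Definition shift_perm p : {perm (X * bool)%type} := perm (@shift_inj p).

(** Within one copy of [X] a shift never matches distinct vertices. Across the copies, both
    endpoints must land on the same point of [K], and this point determines both components of
    [p]. *)
Lemma card_matched_shift (K : {set X}) (t u : X * bool) : t != u ->
  (#|[set p | matched K (shift p t) (shift p u)]| <= #|K|)%N.
Proof.
case: t u => [x b] [y c] tu.
rewrite -(@card_in_imset _ _ (fun p => (shift p (x, b)).1)).
  apply/subset_leq_card/fintype.subsetP => _ /imsetP[p + ->].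
  by rewrite inE => /andP[].
move=> p p'; rewrite !inE /matched /= => /andP[/eqP e _] /andP[/eqP e' _].
case: p e => p1 p2; case: p' e' => p1' p2' /=.
case: b c tu => -[] //= tu e' e.
- by move: tu; rewrite (addIr _ e) eqxx.
- by move=> E; move: e'; rewrite -E e => /addrI ->; move/addrI: E => ->.
- by move=> E; move: e'; rewrite -E e => /addrI ->; move/addrI: E => ->.
- by move: tu; rewrite (addIr _ e) eqxx.
Qed.

Lemma card_touched_shift (K : {set X}) (s : seq ((X * bool) * (X * bool))) :
  {in s, forall e, e.1 != e.2} ->
  (#|[set p | has (fun e => matched K (shift p e.1) (shift p e.2)) s]|
     <= size s * #|K|)%N.
Proof.
elim: s => [|e s IH] ne /=.
  by rewrite card_setE big1.
apply: leq_trans (_ : #|[set p | matched K (shift p e.1) (shift p e.2)] :|: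
   [set p | has (fun e => matched K (shift p e.1) (shift p e.2)) s]| <= _)%N.
  by apply/subset_leq_card/fintype.subsetP => p; rewrite !inE.
apply: leq_trans (leq_card_setU _ _) _; rewrite mulSn; apply: leq_add.
  by apply: card_matched_shift; apply: ne; rewrite mem_head.
by apply: IH => e' e's; apply: ne; rewrite inE e's orbT.
Qed.

End Shift.

(** * Randomised runs *)

Lemma run_ask (Out : Type) (A : strategy Out) (G : ugraph) (O : oracle G)
    q s h y : A h = Ask Out y ->
  run A O q.+1 s h = run A O q (respond O s y).2 (rcons h (respond O s y).1).
Proof. by move=> /= ->; case: (respond O s y). Qed.

Section Measurability.
Variables (R : realType) (A : rand_algorithm R) (G : ugraph) (O : oracle G).
Local Open Scope classical_set_scope.

(** This enumerates the queries by a countable type, so that splitting a run by its first query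
    gives a countable union of events. *)
Definition query_of (c : option (nat * nat)) : query :=
  if c is Some (l, i) then Neighbour l i else Init.

Lemma measurable_run_output (B : set R) q s h : measurable B ->
  measurable [set w : coin A | exists2 x : R,
    run (strat w) O q s h = Some x & B x].
Proof.
move=> mB; elim: q s h => [|q IH] s h.
  rewrite (_ : [set w | _] =
      [set w : coin A | exists2 x : R, B x & strat w h = Output x]).
    exact: strat_output_measurable.
  apply/seteqP; split=> w /= [x].
    by case E: (strat w h) => [y|z] // [<-] Bz; exists z.
  by move=> Bx ->; exists x.
rewrite (_ : [set w | _] =
  [set w : coin A | exists2 x : R, B x & strat w h = Output x] `|`
  \bigcup_(c : option (nat * nat))
    ([set w : coin A | strat w h = Ask R (query_of c)] `&`
     [set w : coin A | exists2 x : R,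
        run (strat w) O q (respond O s (query_of c)).2
          (rcons h (respond O s (query_of c)).1) = Some x & B x])).
  apply: measurableU; first exact: strat_output_measurable.
  apply: countable_bigcupT_measurable; first exact: countableP.
  by move=> c; apply: measurableI; [exact: strat_ask_measurable|exact: IH].
apply/seteqP; split=> w.
  move=> [x]; case E: (strat w h) => [y|z]; last first.
    by rewrite /= E => -[<-] Bz; left; exists z.
  rewrite (run_ask _ _ _ E) => H Bx; right.
  exists (if y is Neighbour l i then Some (l, i) else None) => //.
  by case: y E H => [|l i] E H; split=> //; exists x.
move=> [[x Bx /= ->]|[c _ [E [x H Bx]]]]; first by exists x.
by exists x => //; rewrite (run_ask _ _ _ E).
Qed.

Variable alpha : R.

Lemma measurable_accurate : measurable [set x : R | accurate G alpha x].
Proof.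
rewrite (_ : [set x | _] =
  `[#|G|%:R - alpha * #|G|%:R, #|G|%:R + alpha * #|G|%:R]).
  exact: measurable_itv.
apply/seteqP; split=> x /=; rewrite /accurate in_itv /= ler_norml.
  by move=> /andP[h1 h2]; apply/andP; split; lra.
by move=> /andP[h1 h2]; apply/andP; split; lra.
Qed.

Lemma measurable_estimates_within q :
  measurable [set w : coin A | exists2 x : R,
    output_within (strat w) O q = Some x & accurate G alpha x].
Proof. exact: measurable_run_output measurable_accurate. Qed.

Lemma measurable_estimates :
  measurable [set w : coin A | exists q : nat, exists2 x : R,
    output_within (strat w) O q = Some x & accurate G alpha x].
Proof.
rewrite (_ : [set w | _] = \bigcup_q [set w : coin A | exists2 x : R,
    output_within (strat w) O q = Some x & accurate G alpha x]).
  by apply: bigcupT_measurable => q; exact: measurable_estimates_within.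
by apply/seteqP; split=> w /= [q]; [move=> H; exists q|move=> _ H; exists q].
Qed.

End Measurability.

Section ProbabilityCounting.
Variables (R : realType) (d : measure_display) (T : measurableType d).
Variable P : probability T R.
Local Open Scope classical_set_scope.

(** Union bound on the complements, each of probability at most 1 / 3. *)
Lemma probability_two_thirdsI (U V : set T) : measurable U -> measurable V ->
  ((2 / 3)%:E <= P U)%E -> ((2 / 3)%:E <= P V)%E -> ((1 / 3)%:E <= P (U `&` V))%E.
Proof.
move=> mU mV PU PV; have mUV := measurableI _ _ mU mV.
have : (P (~` (U `&` V)) <= P (~` U) + P (~` V))%E.
  by rewrite setCI; apply: measureU2; exact: measurableC.
rewrite (probability_setC P mUV) (probability_setC P mU) (probability_setC P mV).
have fin B : measurable B -> P B = (fine (P B))%:E.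
  by move=> mB; rewrite fineK // fin_num_measure.
move: PU PV.
rewrite (fin U) // (fin V) // (fin (U `&` V)) // -!EFinB -EFinD !lee_fin.
by lra.
Qed.

(** The sum is the expected number of events [D i] that occur, and at every point at most [N] of
    them do. *)
Lemma sum_probability_le (I : finType) (D : I -> set T) (N : nat) :
  (forall i, measurable (D i)) ->
  (forall w, exists2 B : {set I}, (#|B| <= N)%N & forall i, D i w -> i \in B) ->
  (\sum_i P (D i) <= N%:R%:E)%E.
Proof.
move=> mD HN.
have -> : (\sum_i P (D i) = \int[P]_w \sum_(i : I) (\1_(D i) w)%:E)%E.
  rewrite ge0_integral_sum //.
    by apply: eq_bigr => i _; rewrite integral_indic // setIT.
  by move=> i; apply/measurable_EFinP; exact: measurable_indic.
apply: le_trans (_ : \int[P]_w (N%:R%:E) <= _)%E.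
  apply: ge0_le_integral => //.
  - by move=> w _; apply: sume_ge0 => i _; rewrite lee_fin.
  - apply: emeasurable_sum => i.
    by apply/measurable_EFinP; exact: measurable_indic.
  move=> w _; have [B BN DB] := HN w.
  rewrite sumEFin lee_fin; apply: le_trans (_ : #|B|%:R <= _); last first.
    by rewrite ler_nat.
  rewrite -sum1_card natr_sum [leRHS]big_mkcond; apply: ler_sum => i _.
  rewrite indicE; case: (boolP (i \in B)) => [_|iB].
    by rewrite -[leRHS]/(true%:R) ler_nat leq_b1.
  by rewrite memNset // => /DB; apply/negP.
have PT : (P : {measure set T -> \bar R}) setT = 1%E := probability_setT P.
by rewrite integral_cst // PT mule1.
Qed.

End ProbabilityCounting.

Lemma ex_set_card (X : finType) (k : nat) : (k <= #|X|)%N ->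
  exists K : {set X}, #|K| = k.
Proof.
move=> kX; exists [set x in take k (enum X)].
by rewrite cardsE (card_uniqP _) ?take_uniq ?enum_uniq // size_takel // -cardE.
Qed.

(** * Query bound for a pair of hub graphs that share their clique *)

Section HubQueryBound.
Variables (R : realType) (X : finZmodType) (K : {set X}) (L L' : nat).
Variables (alpha : R) (A : rand_algorithm R) (q : nat).
Hypothesis disjoint : forall x : R,
  accurate (hub K L) alpha x -> ~~ accurate (hub K L') alpha x.
Hypothesis small_within : forall O : oracle (hub K L),
  estimates_within A O alpha q.
Hypothesis large : forall O : oracle (hub K L'), estimates A O alpha.
Local Open Scope classical_set_scope.

Let t0 : X * bool := (0, false).

Let both (p : X * X) : set (coin A) :=
  [set w : coin A | exists2 x : R,
    output_within (strat w) (hub_oracle K L t0 (shift_perm p)) q = Some x &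
    accurate (hub K L) alpha x] `&`
  [set w : coin A | exists q' : nat, exists2 x : R,
    output_within (strat w) (hub_oracle K L' t0 (shift_perm p)) q' = Some x &
    accurate (hub K L') alpha x].

(* If no probed clique edge is rerouted by the shift p, the run on the small
   hub is the run on the clique, which is also the run on the large hub. *)
Lemma both_touched p w : both p w ->
  has (fun e => matched K (shift p e.1) (shift p e.2))
    (touched (strat w) (clique_oracle t0) q [::] [::]).
Proof.
move=> [[x Ox ax] [q' [x' Ox' ax']]]; apply/negPn/negP => untouched.
have good : all (fun e => ~~ matched K (shift_perm p e.1) (shift_perm p e.2))
    (touched (strat w) (clique_oracle t0) q [::] [::]).
  rewrite -all_predC in untouched.
  by apply: sub_all untouched => e /=; rewrite !permE.
have /esym := hub_output L good; rewrite -(hub_output L' good) Ox => O'x.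
by have := disjoint ax; rewrite (output_within_unique O'x Ox') ax'.
Qed.

Lemma hub_query_bound : (#|X| * #|X| <= 3 * (q * #|K|))%N.
Proof.
have mboth p : measurable (both p).
  apply: measurableI; first exact: measurable_estimates_within.
  exact: measurable_estimates.
have third p : ((1 / 3)%:E <= coin_law A (both p))%E.
  apply: probability_two_thirdsI (small_within _) (large _).
    exact: measurable_estimates_within.
  exact: measurable_estimates.
have : (\sum_(p : X * X) coin_law A (both p) <= (q * #|K|)%:R%:E)%E.
  apply: sum_probability_le => // w.
  set s := touched (strat w) (clique_oracle t0) q [::] [::].
  exists [set p | has (fun e => matched K (shift p e.1) (shift p e.2)) s]%SET.
    have distinct : {in s, forall e, e.1 != e.2}.
      by move=> e /(@touched_edge _ _ _ (clique_oracle t0)).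
    apply: leq_trans (card_touched_shift K distinct) _.
    by rewrite leq_mul2r size_touched orbT.
  by move=> p /both_touched; rewrite inE.
move=> /(le_trans (lee_sum _ (fun p _ => third p))).
rewrite sumEFin lee_fin sumr_const card_prod -mulr_natr => le3.
rewrite -(ler_nat R) [leRHS]natrM; lra.
Qed.

End HubQueryBound.

(** * Separation of sizes, choice of parameters and the final bound *)

Lemma accurate_separated (R : realType) (eps delta : R)
    (eps_gt0 : 0 < eps) (eps_le : eps <= 1 / 2)
    (delta_gt0 : 0 < delta) (delta_lt : delta < eps / 2)
    (G G' : ugraph) (x : R) :
  #|G|%:R * (1 - delta) < #|G'|%:R * (1 - eps) ->
  accurate G ((eps - delta) / (2 - eps - delta)) x ->
  ~~ accurate G' ((eps - delta) / (2 - eps - delta)) x.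
Proof.
rewrite /accurate; set n : R := #|G|%:R; set n' : R := #|G'|%:R => nn' /[!ler_norml].
(* For the accuracy alpha of the statement, 1 + alpha = 2 (1 - delta) / d and 1 - alpha = 2 (1 -
   eps) / d. Hence the hypothesis says n (1 + alpha) < n' (1 - alpha). *)
set d := 2 - eps - delta; have d0 : 0 < d by rewrite /d; lra.
rewrite mulrAC => /andP[+ _]; rewrite -mulNr ler_pdivrMr // => xn.
apply/negP; rewrite mulrAC => /andP[_]; rewrite ler_pdivlMr // => xn'.
by move: xn xn'; rewrite /d; nra.
Qed.

(** With no query the output is decided by [strat w [::]] alone, hence is the same for n and 2 n
    vertices, and no number is accurate for both. *)
Lemma clique_query_bound (R : realType) (eps delta : R)
    (eps_gt0 : 0 < eps) (eps_le : eps <= 1 / 2)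
    (delta_gt0 : 0 < delta) (delta_lt : delta < eps / 2)
    (A : rand_algorithm R) (n q : nat) : (0 < n)%N ->
  (forall O : oracle (clique 'I_n),
     estimates_within A O ((eps - delta) / (2 - eps - delta)) q) ->
  (forall O : oracle (clique 'I_(n * 2)),
     estimates A O ((eps - delta) / (2 - eps - delta))) -> (0 < q)%N.
Proof.
case: n => // n _ within est; rewrite lt0n; apply/eqP => q0; subst q.
have O : oracle (clique 'I_n.+1) := clique_oracle ord0.
have O' : oracle (clique 'I_(n.+1 * 2)) := clique_oracle ord0.
have := probability_two_thirdsI (measurable_estimates_within _ _ _ _)
  (measurable_estimates _ _ _) (within O) (est O').
rewrite (_ : _ `&` _ = set0)%classic.
  by rewrite measure0 lee_fin; lra.
apply/seteqP; split=> // w /= [[x Ox ax] [q' [x' Ox' ax']]].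
have O'x : output_within (strat w) O' 0 = Some x.
  by move: Ox; rewrite /output_within /=; case: (strat w [::]).
rewrite -(output_within_unique O'x Ox') in ax'.
suff sep : #|clique 'I_n.+1|%:R * (1 - delta) <
    #|clique 'I_(n.+1 * 2)|%:R * (1 - eps).
  have := accurate_separated eps_gt0 eps_le delta_gt0 delta_lt sep ax.
  by rewrite ax'.
rewrite /= !card_ord natrM; have : 0 < n.+1%:R :> R by rewrite ltr0n.
by nra.
Qed.

Lemma hub_conductance_range (R : realType) (eps delta : R)
    (eps_gt0 : 0 < eps) (eps_le : eps <= 1 / 2)
    (delta_gt0 : 0 < delta) (delta_lt : delta < eps / 2)
    (X : finType) (K : {set X}) (L : nat) (N phi : R) :
  100 <= delta * N -> 0 < phi -> phi <= 1 -> 1 <= phi * N ->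
  phi * N / 4 <= #|K|%:R -> #|K|%:R <= 5 / 4 * (phi * N) ->
  (1 - delta / 8) * N - 2 <= (#|X| * 2)%:R ->
  (1 - eps + delta / 8) * #|hub K L|%:R <= (#|X| * 2)%:R ->
  delta * N / 16 <= L%:R -> #|hub K L|%:R <= 2 * N + 1 ->
  delta / 32 * phi <= gen_conductance (hub K L) eps <= 100 / delta * phi.
Proof.
move=> dN phi0 phi1 phiN Kge Kle Xge Xhub Lge hubN.
have N1 : 1 <= N by nra.
have K0 : (0 < #|K|)%N by rewrite -(ltr0n R); lra.
have hubE : #|hub K L|%:R = (#|X| * 2)%:R + L%:R + 1 :> R.
  by rewrite card_hub natrD -[L.+1]addn1 natrD addrA.
have L0 : (0 < L)%N by rewrite -(ltr0n R); lra.
have X0 : 0 <= (#|X| * 2)%:R :> R by [].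
apply/andP; split.
  apply: (@hub_gen_conductance_ge _ _ _ _ _ (delta / 8)) => //.
  - by lra.
  - by nra.
  - by nra.
  - by nra.
  - by nra.
  (* The hub condition holds because [#|K|] is at least phi N / 4, [L] is at most 2 N + 1 and delta
     < 1 / 4. *)
  rewrite natrD ![(_ * 2)%:R]natrM.
  have : (1 / 4 - delta) * (phi * (2 * N + 1)) >= 0 by nra.
  have : #|K|%:R * (1 - delta / 32 * phi) >= #|K|%:R * (1 / 2) :> R.
    by rewrite ler_wpM2l //; nra.
  have : delta * phi * L%:R <= delta * phi * (2 * N + 1).
    by rewrite ler_wpM2l //; [nra | lra].
  by nra.
apply: le_trans (hub_gen_conductance_le _ _) _ => //.
  rewrite -[L.+1]addn1 natrD; have : 0 <= #|hub K L|%:R :> R by [].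
  by nra.
(* The bounds on [#|K|] and [L] would give 20 / delta; the constant 100 / delta comes from the case
   of bounded n. *)
rewrite ler_pdivrMr ?ltr0n //; apply: le_trans Kle _.
have phid : 0 < 100 / delta * phi by rewrite mulr_gt0 // divr_gt0.
apply: le_trans (_ : 100 / delta * phi * (delta * N / 16) <= _); last first.
  by rewrite ler_pM2l.
rewrite (_ : _ * (_ / 16) = 25 / 4 * (phi * N)); first by lra.
by field; rewrite lt0r_neq0.
Qed.

(** Up to rounding, r is (1 - delta / 8) n / 2, k is phi n / 4 and n' is the separation threshold v
    = n (1 - delta) / (1 - eps). Rounding k and n' up to the next integer gives k >= 1 and strict
    separation. Since v <= 2 n, (1 - eps + delta / 8) n' is about (1 - 3 delta / 4) n at most, and
    100 <= delta n absorbs the rounding. *)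
Lemma hub_parameters (R : realType) (eps delta phi : R) (n : nat)
    (eps_gt0 : 0 < eps) (eps_le : eps <= 1 / 2)
    (delta_gt0 : 0 < delta) (delta_lt : delta < eps / 2) :
  phi <= 1 -> 1 <= phi * n%:R -> 100 <= delta * n%:R ->
  exists r k n' : nat,
    [/\ (k <= r)%N, (r * 2 + 1 <= n)%N, (n <= n')%N &
    [/\ phi * n%:R / 4 <= k%:R, k%:R <= 5 / 4 * (phi * n%:R), n%:R / 4 <= r%:R :> R &
    [/\ (1 - delta / 8) * n%:R - 2 <= (r * 2)%:R,
        (r * 2)%:R <= (1 - delta / 8) * n%:R,
        n%:R * (1 - delta) < n'%:R * (1 - eps),
        (1 - eps + delta / 8) * n'%:R <= (r * 2)%:R &
        n'%:R <= 2 * n%:R + 1 :> R]]].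
Proof.
move=> phi1 phiN dN.
have N400 : 400 < n%:R :> R by nra.
have dN4 : delta * n%:R <= n%:R / 4 by nra.
have phiN' : phi * n%:R <= n%:R by nra.
have e0 : 0 < 1 - eps by lra.
have ntrunc (x : R) : 0 <= x -> exists2 m : nat, m%:R <= x & x < m%:R + 1.
  by move=> /truncn_itv/andP[le lt]; exists (Num.trunc x); rewrite ?natr1.
have [r rle rgt] : exists2 m : nat, m%:R <= (1 - delta / 8) * n%:R / 2 &
    (1 - delta / 8) * n%:R / 2 < m%:R + 1 by apply: ntrunc; lra.
have [k kle kgt] : exists2 m : nat, m%:R <= phi * n%:R / 4 &
    phi * n%:R / 4 < m%:R + 1 by apply: ntrunc; lra.
have [v vE v0] : exists2 v, v * (1 - eps) = n%:R * (1 - delta) & 0 <= v.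
  exists (n%:R * (1 - delta) / (1 - eps)); first by rewrite mulfVK ?gt_eqF.
  by rewrite divr_ge0 ?mulr_ge0 //; lra.
have [n' n'le n'gt] := ntrunc v v0; clear ntrunc.
have vn' : v * (1 - eps) < (n'%:R + 1) * (1 - eps) by rewrite ltr_pM2r.
have n'v : (n'%:R + 1) * (1 - eps) <= v * (1 - eps) + (1 - eps).
  by rewrite mulrDl mul1r lerD2r ler_pM2r.
have vN : n%:R <= v by rewrite -(ler_pM2r e0) vE; nra.
have vN2 : v <= 2 * n%:R by rewrite -(ler_pM2r e0) vE; nra.
have dn' : delta * (n'%:R + 1) <= delta * (2 * n%:R + 1).
  by rewrite ler_pM2l //; lra.
exists r, k.+1, n'.+1; rewrite -!(ler_nat R) natrD natrM -[k.+1%:R]natr1 -[n'.+1%:R]natr1.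
split; [lra | lra | lra |].
split; [lra | lra | lra |].
split; [lra | lra | lra | | lra].
by lra.
Qed.

Theorem theorem6 (R : realType) (eps delta : R)
    (eps_gt0 : 0 < eps) (eps_le : eps <= 1 / 2)
    (delta_gt0 : 0 < delta) (delta_lt : delta < eps / 2) :
  exists c1 c2 c3 : R, [/\ 0 < c1, 0 < c2, 0 < c3 &
    forall (n : nat) (phi : R), (0 < n)%N -> 1 / n%:R <= phi -> phi <= 1 ->
    exists G : ugraph, [/\ #|G| = n,
      c1 * phi <= gen_conductance G eps <= c2 * phi &
      forall (A : rand_algorithm R) (q : nat),
        (forall G' : ugraph,
           c1 * phi <= gen_conductance G' eps <= c2 * phi ->
           forall O : oracle G',
             estimates A O ((eps - delta) / (2 - eps - delta))) ->
        (forall O : oracle G,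
           estimates_within A O ((eps - delta) / (2 - eps - delta)) q) ->
        c3 * (n%:R / gen_conductance G eps) <= q%:R]].
Proof.
(* The square in the third constant serves the case n < 100 / delta: there delta ^ 2 n / 2000 is at
   most delta / 20, below the conductance eps of the clique, so one query is enough for the
   bound. *)
exists (delta / 32), (100 / delta), (delta ^+ 2 / 2000).
have d2 : 0 < delta ^+ 2 by rewrite exprn_gt0.
split; [lra | by rewrite divr_gt0 | lra |].
move=> n phi n0 phin phi1.
have N0 : 0 < n%:R :> R by rewrite ltr0n.
have phi0 : 0 < phi by apply: lt_le_trans phin; rewrite divr_gt0.
have phiN : 1 <= phi * n%:R by rewrite -ler_pdivrMr.
(* If delta n < 100, then phi >= 1 / n > delta / 100, so every clique lies in the conductance range,
   in particular the one on 2 n vertices. *)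
have [dN|dN] := ltP (delta * n%:R) 100.
  have range (m : nat) : delta / 32 * phi <= gen_conductance (clique 'I_m) eps
      <= 100 / delta * phi.
    have ge : eps <= gen_conductance (clique 'I_m) eps.
      by apply: clique_gen_conductance => //; lra.
    have le := gen_conductance_le1 (clique 'I_m) eps.
    apply/andP; split; first by apply: le_trans ge; nra.
    apply: le_trans le _; rewrite mulrAC ler_pdivlMr //.
    by nra.
  exists (clique 'I_n); split=> //; first by rewrite /= card_ord.
  move=> A q est within.
  have q0 : (0 < q)%N.
    apply: (clique_query_bound eps_gt0 eps_le delta_gt0 delta_lt n0 within).
    exact: est.
  have q1 : 1 <= q%:R :> R by rewrite ler1n.
  apply: le_trans q1 => {est within range}.
  have ge : eps <= gen_conductance (clique 'I_n) eps.
    by apply: clique_gen_conductance => //; lra.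
  rewrite mulrA ler_pdivrMr; last exact: lt_le_trans ge.
  rewrite mul1r; apply: le_trans ge; rewrite expr2.
  have : delta * (delta * n%:R) <= delta * 100 by rewrite ler_pM2l // ltW.
  lra.
have [r [k [n' [kr r2n nn' [kge kle rge [Xge Xle sep Xn' n'N]]]]]] :=
  hub_parameters eps_gt0 eps_le delta_gt0 delta_lt phi1 phiN dN.
have r0 : (0 < r)%N by rewrite -(ltr0n R); lra.
(* The successor form provides the additive group that the shifts need. *)
have cardr : #|'I_r.-1.+1| = r by rewrite card_ord prednK.
have [K cardK] : exists K : {set 'I_r.-1.+1}, #|K| = k.
  by apply: ex_set_card; rewrite cardr.
(* Both graphs share the clique and [K]; the leaves fill up the total to m vertices. *)
pose L m := (m - (r * 2 + 1))%N.
have hubN m : (n <= m)%N -> #|hub K (L m)| = m.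
  move=> nm; rewrite card_hub cardr addnS -addSn -addn1 subnKC //.
  exact: leq_trans r2n nm.
have range m : (n <= m)%N -> (m <= n')%N ->
    delta / 32 * phi <= gen_conductance (hub K (L m)) eps <= 100 / delta * phi.
  move=> nm mn'; apply: (@hub_conductance_range _ _ _ _ _ _ _ _ _ _ n%:R) => //;
    rewrite ?cardK ?cardr ?hubN //.
  - apply: le_trans Xn'; rewrite ler_wpM2l ?ler_nat //; lra.
  - apply: le_trans (_ : (L n)%:R <= _); last by rewrite ler_nat leq_sub2r.
    by rewrite natrB // natrD; lra.
  - by apply: le_trans n'N; rewrite ler_nat.
have rangen := range n (leqnn n) nn'; have rangen' := range n' nn' (leqnn n').
exists (hub K (L n)); split=> //; first exact: hubN.
move=> A q est within; have /andP[ge _] := rangen.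
have qb : (#|'I_r.-1.+1| * #|'I_r.-1.+1| <= 3 * (q * #|K|))%N.
  apply: hub_query_bound within (est _ rangen') => x.
  by apply: accurate_separated => //; rewrite !hubN.
move: qb; rewrite cardr cardK -(ler_nat R) !natrM => qb.
have gc0 : 0 < delta / 32 * phi by rewrite mulr_gt0 // divr_gt0.
rewrite mulrA ler_pdivrMr; last exact: lt_le_trans ge.
apply: le_trans (_ : q%:R * (delta / 32 * phi) <= _); last by rewrite ler_wpM2l.
clear est within range hubN rangen rangen' ge.
have q0 : 0 <= q%:R :> R by [].
have qk : q%:R * k%:R <= q%:R * (5 / 4 * (phi * n%:R)) by rewrite ler_wpM2l.
have rr : n%:R / 4 * (n%:R / 4) <= r%:R * r%:R :> R by apply: ler_pM => //; lra.
(* From n ^ 2 / 16 <= r ^ 2 <= 3 q k <= (15 / 4) q phi n. *)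
have qphi : n%:R / 60 <= q%:R * phi by rewrite -(ler_pM2r N0); lra.
apply: le_trans (_ : delta / 32 * (n%:R / 60) <= _); last first.
  by rewrite [leRHS]mulrCA ler_wpM2l //; lra.
by rewrite expr2; nra.
Qed.
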